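(* Let $\varphi\in[0,\pi)$, $c_1,c_2\in\mathbb{C}$, let $l<m$ be integers, $a_l,\dots,a_m\in\mathbb{C}$ with $a_la_m\neq0$, let $h=\beta e^{i(\frac{\pi}{2}+\varphi)}$ with $\beta\in\mathbb{R}\setminus\{0\}$, and let $$T(p)(x)=\sum_{k=l}^m a_k\,p(x-kh),\qquad p\in\mathbb{C}[x].$$ Suppose that $(l+m)\,h=2\,\mathrm{Im}\left(e^{-i\varphi}(c_2-c_1)\right)\cdot e^{i(\frac{\pi}{2}+\varphi)}$ and that all the zeros in $\mathbb{C}\setminus\{0\}$ of $Q(t)=\sum_{k=l}^m a_kt^k$ lie on the unit circle $\{z\in\mathbb{C}:|z|=1\}$. Then for every polynomial $p$ with all zeros on the line $L_{\varphi,c_1}=\{ae^{i\varphi}+c_1 : a\in\mathbb{R}\}$ such that $T(p)\not\equiv0$, all the roots of $T(p)$ are of multiplicity one.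
   Context: Polynomials have complex coefficients; $l,m$ may be negative, so $Q$ is a Laurent polynomial. *)

(* Defs.v *)
From mathcomp Require Export all_boot all_order all_algebra.
From mathcomp Require Export complex.
From mathcomp Require Export classical_sets reals trigo.

Set Implicit Arguments.
Unset Strict Implicit.
Unset Printing Implicit Defensive.

Import Order.TTheory GRing.Theory Num.Theory.

Local Open Scope ring_scope.
Local Open Scope classical_set_scope.
Local Open Scope complex_scope.

(* Bigop ranges [m <= i < n] only cover nat; this is the sequence of the
   integers k with l <= k <= m, meaningful for l <= m (see [mem_int_range]). *)
Definition int_range (l m : int) : seq int :=
  [seq l + j%:Z | j <- iota 0 `|m - l|%N.+1].

Lemma int_range_uniq (l m : int) : uniq (int_range l m).
Proof. by rewrite map_inj_uniq ?iota_uniq // => i j /addrI []. Qed.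

Lemma mem_int_range (l m k : int) :
  l <= m -> (k \in int_range l m) = (l <= k <= m).
Proof.
move=> lm; have dE : `|m - l|%N%:Z = m - l by rewrite gez0_abs ?subr_ge0.
apply/mapP/andP => [[j]|[lk km]].
  rewrite mem_iota add0n ltnS leq0n /= -lez_nat dE lerBrDl => jm ->.
  by rewrite lerDl.
have kE : `|k - l|%N%:Z = k - l by rewrite gez0_abs ?subr_ge0.
exists `|k - l|%N; last by rewrite kE addrC subrK.
by rewrite mem_iota add0n ltnS leq0n /= -lez_nat dE kE lerD2r.
Qed.

Section Defs.
Variable R : realType.
Implicit Types (a : int -> R[i]) (l m : int) (h c : R[i]) (phi t : R).

(* e^{it} for real t *)
Definition expi t : R[i] := cos t +i* sin t.

Definition line phi c : set R[i] := [set s%:C * expi phi + c | s in setT].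

Definition laurent_eval a l m (z : R[i]) : R[i] :=
  \sum_(k <- int_range l m) a k * z ^ k.

Definition shift_op a l m h (p : {poly R[i]}) : {poly R[i]} :=
  \sum_(k <- int_range l m) a k *: (p \Po ('X - (k%:~R * h)%:P)).

Lemma shift_opE a l m h (p : {poly R[i]}) (x : R[i]) :
  (shift_op a l m h p).[x]
  = \sum_(k <- int_range l m) a k * p.[x - k%:~R * h].
Proof.
rewrite /shift_op horner_sum; apply: eq_bigr => k _.
by rewrite hornerZ horner_comp hornerXsubC.
Qed.

End Defs.

(* Main.v *)
(* The operator T is a product, over the roots t of Q, of the operators
   p |-> p(x - h) - t p(x), applied to a translate of p. Take p with all roots
   on a line parallel to u and h a nonzero real multiple of i u. Off the line
   translated by h / 2 every root of p is strictly nearer to one fixed point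
   among z - h and z, so |p(z - h)| <> |p(z)| and, as |t| = 1, the new roots
   all lie on that translated line. There p'/p differs at z - h and z, so a root
   of the new polynomial cannot be a root of its derivative. Since l < m, at
   least one such factor occurs. *)

Require Import Defs.
From HB Require Import structures.
From mathcomp Require Import ring lra.

Set Implicit Arguments.
Unset Strict Implicit.
Unset Printing Implicit Defensive.

Import Order.TTheory GRing.Theory Num.Theory.

Local Open Scope ring_scope.
Local Open Scope classical_set_scope.
Local Open Scope complex_scope.

(** * Simple roots and logarithmic derivatives *)

Lemma mup_eq1 (F : fieldType) (q : {poly F}) (z : F) :
  root q z -> q^`().[z] != 0 -> mup z q = 1%N.
Proof.
move=> qz0 dqz.
have q0 : q != 0 by apply: contraNneq dqz => ->; rewrite deriv0 horner0.
apply/eqP; rewrite eqn_leq mup_leq// mup_geq// expr1 dvdp_XsubCl qz0 andbT.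
apply: contraNN dqz => /dvdpP[s ->].
by rewrite expr2 !derivM derivXsubC !hornerE/= subrr add0r subrr !mulr0 addr0.
Qed.

Lemma horner_deriv_prod_XsubC (F : fieldType) (rs : seq F) (x : F) :
  x \notin rs ->
  (\prod_(r <- rs) ('X - r%:P))^`().[x] =
  (\prod_(r <- rs) ('X - r%:P)).[x] * \sum_(r <- rs) (x - r)^-1.
Proof.
elim: rs => [|r rs IH]; first by rewrite !big_nil derivC horner0 mulr0.
rewrite inE negb_or => /andP[xr xrs].
rewrite !big_cons derivM derivXsubC mul1r !hornerE IH//.
have : x - r != 0 by rewrite subr_eq0.
by move=> ?; field.
Qed.

(** * Polynomials acting through a linear operator *)

Section LinearPolynomialAction.
Variables (F : fieldType) (V : lmodType F) (S : {linear V -> V}).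

(** This is [A(S) v]: substituting [S] for the variable makes [V] a module over the polynomials. *)
Definition poly_act (A : {poly F}) (v : V) : V :=
  \sum_(j < size A) A`_j *: iter j S v.

Lemma poly_act_widen (N : nat) (A : {poly F}) (v : V) :
  (size A <= N)%N -> poly_act A v = \sum_(j < N) A`_j *: iter j S v.
Proof.
move=> sA; rewrite /poly_act (big_ord_widen N (fun j => A`_j *: iter j S v))//.
rewrite big_mkcond/=; apply: eq_bigr => j _; case: ltnP => // ?.
by rewrite nth_default// scale0r.
Qed.

Lemma poly_act_XsubCM (A : {poly F}) (t : F) (v : V) :
  poly_act (('X - t%:P) * A) v = S (poly_act A v) - t *: poly_act A v.
Proof.
rewrite (@poly_act_widen (size A).+1 (_ * _)); last first.
  by apply: leq_trans (size_polyMleq _ _) _; rewrite size_XsubC.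
rewrite [in t *: _](@poly_act_widen (size A).+1)//.
rewrite mulrBl raddf_sum scaler_sumr.
under eq_bigr do rewrite coefB coefXM coefCM scalerBl -scalerA.
rewrite sumrB; congr (_ - _).
rewrite big_ord_recl/= scale0r add0r; apply: eq_bigr => j _.
by rewrite linearZ.
Qed.

Definition apply_factors (ts : seq F) (v : V) : V :=
  foldr (fun t w => S w - t *: w) v ts.

(** Splitting [A] into linear factors splits [A(S)] into first-order operators; the leading
    coefficient is moved onto the vector. *)
Lemma poly_act_factors (ts : seq F) (c : F) (v : V) :
  poly_act (c *: \prod_(t <- ts) ('X - t%:P)) v = apply_factors ts (c *: v).
Proof.
rewrite -mul_polyC mulrC; elim: ts => [|t ts IH].
  rewrite big_nil mul1r (@poly_act_widen 1) ?size_polyC ?leq_b1//.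
  by rewrite big_ord1 coefC.
by rewrite big_cons -mulrA poly_act_XsubCM IH.
Qed.

End LinearPolynomialAction.

(** * One first-order factor, [p(x - h) - t p(x)] *)

Section ShiftStep.
Variables (R : realType) (u : R[i]) (beta : R) (h : R[i]).
Hypotheses (u0 : u != 0) (beta0 : beta != 0) (hE : h = (0 +i* beta) * u).

Definition roots_on_line (c : R[i]) (p : {poly R[i]}) :=
  forall z, root p z -> exists s : R, z = s%:C * u + c.

Definition shift_step (t : R[i]) (p : {poly R[i]}) : {poly R[i]} :=
  p \Po ('X - h%:P) - t *: p.

(** In the coordinates [(x +i* y) * u + c] the line of roots is [y = 0], and subtracting [h] only
    lowers [y] by [beta]. *)
Lemma line_diff (c : R[i]) (x y s : R) :
  (x +i* y) * u + c - (s%:C * u + c) = ((x - s) +i* y) * u.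
Proof.
have -> : (x - s) +i* y = (x +i* y) - s%:C.
  by apply/eqP; rewrite eq_complex/= subr0 !eqxx.
by ring.
Qed.

Lemma line_diff_shift (c : R[i]) (x y s : R) :
  (x +i* y) * u + c - h - (s%:C * u + c) = ((x - s) +i* (y - beta)) * u.
Proof.
have -> : (x - s) +i* (y - beta) = (x +i* y) - s%:C - (0 +i* beta).
  by apply/eqP; rewrite eq_complex/= !subr0 !eqxx.
by rewrite hE; ring.
Qed.

Lemma ltc_norm (x y y' : R) :
  (`|x +i* y| < `|x +i* y'|) = (y ^+ 2 < y' ^+ 2).
Proof.
rewrite -ltr_sqr ?nnegrE//.
by rewrite -!add_Re2_Im2/= ltcR ltrD2l.
Qed.

(** A constant [p] has no root whose distances could be compared, so this degenerate case is set
    apart. *)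
Lemma shift_step_const_root (t z : R[i]) (p : {poly R[i]}) :
  (size p <= 1)%N -> root (shift_step t p) z -> shift_step t p = 0.
Proof.
move=> /size1_polyC ->; rewrite /shift_step comp_polyC -mul_polyC -polyCM -polyCB.
by rewrite rootC => /eqP ->.
Qed.

Lemma line_factorization (c : R[i]) (p : {poly R[i]}) :
  roots_on_line c p -> (1 < size p)%N ->
  exists2 ss : seq R, (0 < size ss)%N &
    p = lead_coef p *: \prod_(r <- [seq s%:C * u + c | s <- ss]) ('X - r%:P).
Proof.
move=> pc sp; have p0 : p != 0 by rewrite -size_poly_gt0 (leq_trans _ sp).
have [rs pE] := closed_field_poly_normal p.
have [ss rsE] : exists ss : seq R, rs = [seq s%:C * u + c | s <- ss].
  have : {in rs, forall r, root p r}.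
    by move=> r rrs; rewrite pE rootZ ?lead_coef_eq0// root_prod_XsubC.
  elim: rs {pE} => [|r rs IH] rrs; first by exists [::].
  have [|ss ->] := IH; first by move=> x xrs; rewrite rrs// inE xrs orbT.
  by have [s ->] := pc r (rrs r (mem_head _ _)); exists (s :: ss).
exists ss; last by rewrite -rsE.
rewrite lt0n; apply: contraTneq sp => /size0nil ss0.
by rewrite pE rsE ss0 big_nil -leqNgt (leq_trans (size_scale_leq _ _))// size_poly1.
Qed.

(** The distances from [z] and [z - h] to a root of [p] differ only through [y ^+ 2] and
    [(y - beta) ^+ 2]. Equal moduli of [p] force these squares to agree, so [y = beta / 2]. *)
Lemma shift_step_root_line (c t z : R[i]) (p : {poly R[i]}) :
  `|t| = 1 -> roots_on_line c p -> shift_step t p != 0 ->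
  root (shift_step t p) z -> exists x : R, z = (x +i* (beta / 2)) * u + c.
Proof.
move=> t1 pc q0 qz.
have [/shift_step_const_root/(_ qz)/eqP|sp] := leqP (size p) 1.
  by rewrite (negPf q0).
have p0 : p != 0 by rewrite -size_poly_gt0 (leq_trans _ sp).
have [ss ss0 pE] := line_factorization pc sp.
have hss : has predT ss by rewrite has_predT.
have : `|p.[z - h]| = `|p.[z]|.
  move: qz; rewrite /root /shift_step !hornerE horner_comp !hornerE subr_eq0.
  by move=> /eqP ->; rewrite normrM t1 mul1r.
case wE : ((z - c) / u) => [x y].
have zE : z = (x +i* y) * u + c by rewrite -wE; field.
have normE (v : R[i]) :
    `|p.[v]| = `|lead_coef p| * \prod_(s <- ss) `|v - (s%:C * u + c)|.
  rewrite {1}pE hornerZ normrM horner_prod normr_prod big_map.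
  by under eq_bigr do rewrite hornerXsubC.
have prodE (y' : R) (v : R[i]) :
    (forall s, v - (s%:C * u + c) = ((x - s) +i* y') * u) ->
    \prod_(s <- ss) `|v - (s%:C * u + c)| = \prod_(s <- ss) (`|(x - s) +i* y'| * `|u|).
  by move=> vE; apply: eq_bigr => s _; rewrite vE normrM.
rewrite !normE zE (prodE _ _ (line_diff c x y)) (prodE _ _ (line_diff_shift c x y)).
move=> /(mulfI (_ : `|lead_coef p| != 0)).
rewrite normr_eq0 lead_coef_eq0 => /(_ p0) E.
(* The product inequality is strict because [ss] is nonempty, [p] being nonconstant. *)
have ltP (y1 y2 : R) : y1 ^+ 2 < y2 ^+ 2 ->
    \prod_(s <- ss) (`|(x - s) +i* y1| * `|u|) <
    \prod_(s <- ss) (`|(x - s) +i* y2| * `|u|).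
  move=> y12; apply: ltr_prod => // s _.
  by rewrite mulr_ge0//= ltr_pM2r ?normr_gt0// ltc_norm.
have [/ltP|/ltP|yb] := ltrgtP (y ^+ 2) ((y - beta) ^+ 2).
- by rewrite E ltxx.
- by rewrite E ltxx.
- exists x; have -> // : beta / 2 = y.
  have : beta * (2 * y - beta) = 0.
    have -> : beta * (2 * y - beta) = y ^+ 2 - (y - beta) ^+ 2 by ring.
    by rewrite yb subrr.
  by move/eqP; rewrite mulf_eq0 (negPf beta0)/= => /eqP; lra.
Qed.

Lemma shift_step_roots_on_line (c t : R[i]) (p : {poly R[i]}) :
  `|t| = 1 -> roots_on_line c p -> shift_step t p != 0 ->
  roots_on_line (c + (0 +i* (beta / 2)) * u) (shift_step t p).
Proof.
move=> t1 pc q0 z /(shift_step_root_line t1 pc q0)[x ->]; exists x.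
have -> : x +i* (beta / 2) = x%:C + (0 +i* (beta / 2)).
  by apply/eqP; rewrite eq_complex/= addr0 add0r !eqxx.
by ring.
Qed.

(* On the line carrying the roots of [shift_step t p], the logarithmic
   derivatives of [p] at [z - h] and at [z] differ by [h / u ^+ 2] times a
   positive real, one summand per root of [p]. *)
Lemma shift_step_deriv_neq0 (c t z : R[i]) (p : {poly R[i]}) :
  `|t| = 1 -> roots_on_line c p -> shift_step t p != 0 ->
  root (shift_step t p) z -> (shift_step t p)^`().[z] != 0.
Proof.
move=> t1 pc q0 qz.
have [/shift_step_const_root/(_ qz)/eqP|sp] := leqP (size p) 1.
  by rewrite (negPf q0).
have p0 : p != 0 by rewrite -size_poly_gt0 (leq_trans _ sp).
have [x zE] := shift_step_root_line t1 pc q0 qz.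
have [ss ss0 pE] := line_factorization pc sp.
pose b := beta / 2; have b0 : b != 0 by rewrite mulf_neq0 ?invr_eq0 ?pnatr_eq0.
have zr s : z - (s%:C * u + c) = ((x - s) +i* b) * u by rewrite zE line_diff.
have zhr s : z - h - (s%:C * u + c) = ((x - s) +i* - b) * u.
  by rewrite zE line_diff_shift; congr ((_ +i* _) * u); rewrite /b; field.
have cb0 (s b' : R) : b' != 0 -> (s +i* b') * u != 0.
  by move=> b'0; rewrite mulf_neq0// eq_complex/= negb_and b'0 orbT.
pose rs := [seq s%:C * u + c | s <- ss].
have zrs : z \notin rs.
  by apply/mapP => -[s _ /eqP]; rewrite -subr_eq0 zr (negPf (cb0 _ _ b0)).
have zhrs : z - h \notin rs.
  apply/mapP => -[s _ /eqP]; rewrite -subr_eq0 zhr.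
  by rewrite (negPf (cb0 _ _ _))// oppr_eq0.
have dE v : v \notin rs -> p^`().[v] = p.[v] * \sum_(r <- rs) (v - r)^-1.
  move=> vrs; rewrite pE derivZ !hornerZ horner_deriv_prod_XsubC//.
  by rewrite mulrA.
have pzh : p.[z - h] = t * p.[z].
  move: qz; rewrite /root /shift_step !hornerE horner_comp !hornerE subr_eq0.
  by move=> /eqP.
(* As [t * p.[z]] is [p.[z - h]], the derivative is [p.[z - h]] times the difference of the sums of
   inverses at [z - h] and at [z]; each factor is then shown nonzero. *)
rewrite /shift_step derivB derivZ deriv_comp derivXsubC mulr1.
rewrite hornerD hornerN hornerZ horner_comp hornerXsubC !dE// pzh.
rewrite mulrA -mulrBr mulf_neq0//.
  rewrite -pzh {1}pE hornerZ mulf_neq0 ?lead_coef_eq0//.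
  by rewrite -[_ == 0]/(root _ _) root_prod_XsubC.
rewrite !big_map -sumrB.
have -> : \sum_(s <- ss) ((z - h - (s%:C * u + c))^-1 - (z - (s%:C * u + c))^-1)
    = h / u ^+ 2 * \sum_(s <- ss) (((x - s) ^+ 2 + b ^+ 2)%:C)^-1.
  rewrite mulr_sumr; apply: eq_bigr => s _.
  (* The two differences are conjugates multiplied by [u], and they differ by [h]; hence the
     numerator [h] and the denominator [u ^+ 2] times a positive real. *)
  have -> : ((x - s) ^+ 2 + b ^+ 2)%:C = ((x - s) +i* b) * ((x - s) +i* - b).
    by apply/eqP; rewrite eq_complex/=; apply/andP; split; apply/eqP; ring.
  have := cb0 (x - s) _ b0; rewrite -zr => zr0.
  have := cb0 (x - s) (- b); rewrite oppr_eq0 -zhr => /(_ b0) zhr0.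
  have e1 : (x - s) +i* b = (z - (s%:C * u + c)) / u by rewrite zr mulfK.
  have e2 : (x - s) +i* - b = (z - h - (s%:C * u + c)) / u by rewrite zhr mulfK.
  by rewrite e1 e2; field; rewrite u0 zr0 zhr0.
rewrite mulf_neq0//.
  rewrite mulf_neq0 ?invr_neq0 ?expf_neq0// hE mulf_neq0//.
  by rewrite eq_complex/= negb_and beta0 orbT.
have pos (s : R) : 0 < (((x - s) ^+ 2 + b ^+ 2)%:C)^-1.
  by rewrite invr_gt0 ltcR ltr_wpDl ?sqr_ge0// exprn_even_gt0.
case: ss ss0 {pE rs zrs zhrs dE} => // s ss _.
by rewrite big_cons gt_eqF// ltr_wpDr// sumr_ge0// => i _; rewrite ltW.
Qed.

(** * Composition of the first-order factors *)

Definition shift : {poly R[i]} -> {poly R[i]} := comp_poly ('X - h%:P).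
HB.instance Definition _ := GRing.Linear.on shift.

(** Each factor moves the line parallel to itself. Inner results are nonzero because a factor sends
    0 to 0. *)
Lemma apply_shift_factors_roots (c : R[i]) (ts : seq R[i]) (p : {poly R[i]}) :
  {in ts, forall t, `|t| = 1} -> roots_on_line c p ->
  apply_factors shift ts p != 0 ->
  exists c', roots_on_line c' (apply_factors shift ts p).
Proof.
elim: ts => [|t ts IH] tsP pc q0; first by exists c.
have t1 : `|t| = 1 by rewrite tsP ?mem_head.
have [||c' qc] := IH _ pc; first by move=> x xts; rewrite tsP// inE xts orbT.
  by apply: contraNneq q0 => /= ->; rewrite raddf0 scaler0 subr0.
by eexists; apply: shift_step_roots_on_line t1 qc q0.
Qed.

(** The inner factors leave all roots on a line parallel to [u], and the outermost one makes the
    roots simple; hence [ts] must be nonempty. *)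
Lemma apply_shift_factors_mup (c z : R[i]) (ts : seq R[i]) (p : {poly R[i]}) :
  (0 < size ts)%N -> {in ts, forall t, `|t| = 1} -> roots_on_line c p ->
  apply_factors shift ts p != 0 -> root (apply_factors shift ts p) z ->
  mup z (apply_factors shift ts p) = 1%N.
Proof.
case: ts => // t ts _ tsP pc q0 qz; apply: mup_eq1 => //.
have t1 : `|t| = 1 by rewrite tsP ?mem_head.
have [|||c' qc] := @apply_shift_factors_roots c ts p.
- by move=> x xts; rewrite tsP// inE xts orbT.
- by [].
- by apply: contraNneq q0 => /= ->; rewrite raddf0 scaler0 subr0.
exact: shift_step_deriv_neq0 t1 qc q0 qz.
Qed.

Lemma iter_shift (j : nat) (p : {poly R[i]}) (g : R[i]) :
  iter j shift (p \Po ('X - g%:P)) = p \Po ('X - (g + j%:R * h)%:P).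
Proof.
elim: j => [|j IH]; first by rewrite mul0r addr0.
rewrite iterS IH /shift -comp_polyA comp_polyB comp_polyX comp_polyC.
by rewrite -addrA -opprD -polyCD; congr (_ \Po ('X - _%:P)); rewrite -natr1; ring.
Qed.

End ShiftStep.

(** * From the Laurent polynomial to an ordinary one *)

Lemma big_int_range (V : nmodType) (F : int -> V) (l m : int) :
  \sum_(k <- int_range l m) F k = \sum_(j < `|m - l|%N.+1) F (l + j%:Z).
Proof. by rewrite -(big_mkord xpredT (fun j => F (l + j%:Z))) /int_range big_map. Qed.

Lemma laurent_polynomialE (R : realType) (a : int -> R[i]) (l m : int) (t : R[i]) :
  t != 0 ->
  laurent_eval a l m t = t ^ l * (\poly_(j < `|m - l|%N.+1) a (l + j%:Z)).[t].
Proof.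
move=> t0; rewrite /laurent_eval big_int_range horner_poly mulr_sumr.
by apply: eq_bigr => j _; rewrite expfzDr//= mulrCA.
Qed.

(** The factor [t ^ l] of the Laurent polynomial becomes a preliminary translation of [p] by
    [l h]. *)
Lemma shift_op_poly_act (R : realType) (a : int -> R[i]) (l m : int) (h : R[i])
    (p : {poly R[i]}) :
  shift_op a l m h p =
  @poly_act R[i] {poly R[i]} (shift h) (\poly_(j < `|m - l|%N.+1) a (l + j%:Z))
    (p \Po ('X - (l%:~R * h)%:P)).
Proof.
rewrite (@poly_act_widen _ _ _ `|m - l|%N.+1) ?size_poly// /shift_op big_int_range.
apply: eq_bigr => j _; rewrite coef_poly ltn_ord iter_shift.
by rewrite -mulrDl intrD.
Qed.

Theorem theorem2p4 (R : realType) (phi : R) (hphi : 0 <= phi < pi)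
    (c1 c2 : R[i]) (l m : int) (hlm : l < m)
    (a : int -> R[i]) (ha : a l * a m != 0)
    (beta : R) (hbeta : beta != 0)
    (h : R[i]) (hh : h = beta%:C * expi (pi / 2 + phi))
    (hline : (l + m)%:~R * h =
       (2 * complex.Im (expi (- phi) * (c2 - c1)))%:C * expi (pi / 2 + phi))
    (hQ : forall t : R[i], t != 0 -> laurent_eval a l m t = 0 -> `|t| = 1)
    (p : {poly R[i]}) (hp : forall z : R[i], root p z -> line phi c1 z)
    (hT : shift_op a l m h p != 0) :
  forall z : R[i], root (shift_op a l m h p) z ->
    mup z (shift_op a l m h p) = 1%N.
Proof.
have u0 : expi phi != 0.
  rewrite eq_complex/=; apply/negP => /andP[/eqP c0 /eqP s0].
  by have /eqP := cos2Dsin2 phi; rewrite c0 s0 expr0n addr0 eq_sym oner_eq0.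
have hE : h = (0 +i* beta) * expi phi.
  rewrite hh /expi addrC cosDpihalf sinDpihalf.
  by apply/eqP; rewrite eq_complex/=; apply/andP; split; apply/eqP; ring.
move: ha; rewrite mulf_eq0 negb_or => /andP[al am].
have dE : `|m - l|%N%:Z = m - l by rewrite gez0_abs// subr_ge0 ltW.
pose Q := \poly_(j < `|m - l|%N.+1) a (l + j%:Z).
have lE : l + `|m - l|%N%:Z = m by rewrite dE addrC subrK.
have sQ : size Q = `|m - l|%N.+1 by rewrite size_poly_eq//= lE.
have Q0 : Q != 0 by rewrite -size_poly_eq0 sQ.
have [ts QE] := closed_field_poly_normal Q.
have ts1 : {in ts, forall t, `|t| = 1}.
  move=> t tts; have Qt : root Q t.
    by rewrite QE rootZ ?lead_coef_eq0// root_prod_XsubC.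
  (* The constant coefficient of [Q] is [a l], which is nonzero. *)
  have t0 : t != 0.
    apply: contraTneq Qt => ->.
    by rewrite /root horner_coef0 coef_poly/= addr0.
  by apply: hQ => //; rewrite laurent_polynomialE// (eqP Qt) mulr0.
(* [Q] has degree [m - l], which is positive. *)
have ts0 : (0 < size ts)%N.
  move: sQ; rewrite QE size_scale ?lead_coef_eq0// size_prod_XsubC => -[->].
  by rewrite absz_gt0 subr_eq0 gt_eqF.
move: hT; rewrite shift_op_poly_act -/Q QE poly_act_factors => qn0 z qz.
(* Translating [p] by [l h] carries its line of roots to the parallel one through [c1 + l h]. *)
apply: (apply_shift_factors_mup u0 hbeta hE (c := c1 + l%:~R * h)) => //.
move=> x.
rewrite rootZ ?lead_coef_eq0// /root horner_comp hornerXsubC => /hp[s _ sE].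
by exists s; rewrite addrA sE subrK.
Qed.
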